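(* Fix $t\in\mathbb{R}$ and let $\alpha_{i,n}$, $1\le i\le n$, be the local levels of the one-sided higher criticism (HC) test based on the critical value $d_n(t)$. Then $$\lim_{n\to\infty}\ \max_{1\le i\le n}\alpha_{i,n}=0 .$$
   Context: Let $u_n=\log(\log(n))$ and, for fixed $t\in\mathbb{R}$, $d_n(t)=\bigl(t+2u_n+(\log(u_n)-\log(\pi))/2\bigr)/\sqrt{2u_n}$ (all quantities are considered for $n$ large enough that they are defined and $d_n(t)\ge 1$). For $1\le i\le n$ and $d\geq 1$ let $$h_{i,n}(d)=\frac{d^2+2i-d\sqrt{d^2+4i-4i^2/n}}{2(d^2+n)}.$$ The one-sided HC test based on order statistics $X_{1:n}\le\dots\le X_{n:n}$ of a sample in $[0,1]$ rejects iff $\max_{1\le i\le n}\sqrt n\,(i/n-X_{i:n})/\sqrt{X_{i:n}(1-X_{i:n})}>d_n(t)$, equivalently iff $X_{i:n}<h_{i,n}(d_n(t))$ for some $i$. Its local levels are $$\alpha_{i,n}=\mathbb{P}\bigl(U_{i:n}<h_{i,n}(d_n(t))\bigr)=\mathbb{P}(Z_n\ge i),$$ where $U_{1:n}\le\dots\le U_{n:n}$ are the order statistics of $n$ i.i.d. uniform random variables on $[0,1]$ and $Z_n$ is binomial with parameters $n$ and $h_{i,n}(d_n(t))$. *)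

(* Defs.v *)
From HB Require Import structures.
From mathcomp Require Import all_boot all_order all_algebra.
From mathcomp Require Import all_classical all_reals all_analysis.
Set Implicit Arguments.
Unset Strict Implicit.
Unset Printing Implicit Defensive.
Import Order.TTheory GRing.Theory Num.Theory.
Import numFieldNormedType.Exports.
Local Open Scope classical_set_scope.
Local Open Scope ring_scope.

Section critical_values.
Context {R : realType}.

(* ln, Num.sqrt and division are total, so the quantities below take
   conventional values for the finitely many small n where the usual
   expressions are undefined; limits as n tends to infinity ignore these. *)
Definition hc_u (n : nat) : R := ln (ln n%:R).

Definition hc_d (t : R) (n : nat) : R :=
  (t + 2 * hc_u n + (ln (hc_u n) - ln pi) / 2) / Num.sqrt (2 * hc_u n).

(* For d >= 0, 1 <= i <= n and x in ]0, 1[,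
   sqrt n * (i / n - x) / sqrt (x * (1 - x)) > d  iff  x < hc_h n i d. *)
Definition hc_h (n i : nat) (d : R) : R :=
  (d ^+ 2 + 2 * i%:R
     - d * Num.sqrt (d ^+ 2 + 4 * i%:R - 4 * i%:R ^+ 2 / n%:R))
  / (2 * (d ^+ 2 + n%:R)).

End critical_values.

Section samples.
Context {R : realType} {d : measure_display} {T : measurableType d}.
Variable P : probability T R.

Definition mutually_independent (I : finType) (X : I -> {RV P >-> R}) : Prop :=
  forall (J : {set I}) (B : I -> set R), (forall i, measurable (B i)) ->
    P (\bigcap_(i in [set` J]) (X i @^-1` B i))
    = (\prod_(i in J) P (X i @^-1` B i))%E.

Definition uniform01 (X : {RV P >-> R}) : Prop :=
  forall B : set R, measurable B ->
    distribution P X B = uniform_prob (@ltr01 R) B.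

Definition iid_uniform01 (I : finType) (X : I -> {RV P >-> R}) : Prop :=
  mutually_independent X /\ forall i, uniform01 (X i).

(* The i-th smallest of the n values, with the 1-based index 1 <= i <= n. *)
Definition order_stat (n : nat) (X : 'I_n -> {RV P >-> R}) (i : nat) (w : T) : R :=
  nth 0 (sort <=%R [seq X j w | j <- enum 'I_n]) i.-1.

Definition hc_local_level (t : R) (n : nat) (U : 'I_n -> {RV P >-> R})
    (i : nat) : R :=
  fine (P [set w | order_stat U i w < hc_h n i (hc_d t n)]).

(* Local levels are nonnegative, so the default value 0 of the iterated
   maximum only matters for n = 0. *)
Definition hc_max_local_level (t : R) (n : nat) (U : 'I_n -> {RV P >-> R}) : R :=
  \big[Num.max/0]_(1 <= i < n.+1) hc_local_level t U i.

End samples.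

(* Main.v *)
Require Import Defs.
From HB Require Import structures.
From mathcomp Require Import all_boot all_order all_algebra.
From mathcomp Require Import all_classical all_reals all_analysis.
From mathcomp Require Import measurable_realfun.
From mathcomp Require Import ring lra.
Import Order.TTheory GRing.Theory Num.Theory.
Import numFieldNormedType.Exports.
Local Open Scope classical_set_scope.
Local Open Scope ring_scope.
Set Implicit Arguments.
Unset Strict Implicit.
Unset Printing Implicit Defensive.

(** Why the local levels vanish uniformly: Chebyshev's inequality suffices.

    Fix [n] and [i], write [d] for the critical value and [h = hc_h n i d].
    The event that the [i]-th order statistic is below [h] says that at least
    [i] of the [n] sample points fall below [h] ([order_stat_lt]), and the
    number of such points is a sum of [n] pairwise independent indicators with
    mean [n h] and variance [n h (1 - h)].  The boundary [h] is the smaller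
    root of the quadratic equation obtained by squaring
    [sqrt n (i / n - x) = d sqrt (x (1 - x))]; that is, [i] lies exactly [d]
    standard deviations above the mean [n h] ([hc_h_boundary]).  So every
    local level is at most [1 / d ^ 2], for all [i] at once
    ([hc_local_level_le]).  Since [d] is asymptotic to [sqrt (2 log log n)],
    it tends to infinity ([hc_d_cvgy]), and the maximum of the local levels is
    squeezed to [0]. *)

(** * The critical value and the rejection boundary *)

(** The level [i] is [d] standard deviations above the mean of a binomial
    variable with parameters [n] and [hc_h n i d].  Strict positivity of the
    gap also forces [hc_h n i d] into the open unit interval, since the right
    side of the second identity must then be positive. *)
Lemma hc_h_boundary (R : realType) (n i : nat) (d : R) :
  (0 < i <= n)%N -> 0 < d ->
  0 < i%:R - n%:R * hc_h n i d /\
  (i%:R - n%:R * hc_h n i d) ^+ 2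
    = d ^+ 2 * (n%:R * (hc_h n i d * (1 - hc_h n i d))).
Proof.
move=> /andP[i0 lein] d0; rewrite /hc_h.
have I0 : (0 : R) < i%:R by rewrite ltr0n.
have IN : i%:R <= n%:R :> R by rewrite ler_nat.
have N0 : (0 : R) < n%:R by exact: lt_le_trans IN.
move: (i%:R : R) (n%:R : R) I0 IN N0 => I N I0 IN N0.
(* In terms of q = I / N the discriminant and the gap are polynomials. *)
pose q := I / N.
have EI : I = q * N by rewrite /q divfK// gt_eqF.
have q0 : 0 < q by rewrite divr_gt0.
have q1 : q <= 1 by rewrite ler_pdivrMr// mul1r.
have d2 : 0 < d ^+ 2 by rewrite exprn_gt0.
have -> : d ^+ 2 + 4 * I - 4 * I ^+ 2 / N = d ^+ 2 + 4 * N * (q * (1 - q)).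
  by rewrite EI; field; rewrite gt_eqF.
have t0 : 0 <= 4 * N * (q * (1 - q)).
  by apply: mulr_ge0; apply: mulr_ge0; rewrite ?subr_ge0 // ltW.
set s := Num.sqrt _.
have s2 : s ^+ 2 = d ^+ 2 + 4 * N * (q * (1 - q)).
  by rewrite sqr_sqrtr// addr_ge0// ltW.
have ds : d <= s.
  by rewrite -ler_sqr ?nnegrE ?sqrtr_ge0 ?(ltW d0)// s2 lerDl.
have D0 : 0 < d ^+ 2 + N by rewrite addr_gt0.
have D2 : d ^+ 2 + N != 0 by rewrite gt_eqF.
have gapE : I - N * ((d ^+ 2 + 2 * I - d * s) / (2 * (d ^+ 2 + N)))
    = N * d * (s - d * (1 - 2 * q)) / (2 * (d ^+ 2 + N)).
  by rewrite EI; field.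
split; rewrite gapE.
  rewrite divr_gt0 ?mulr_gt0// subr_gt0 (lt_le_trans _ ds)//.
  by rewrite gtr_pMr//; lra.
apply/eqP; rewrite -subr_eq0; apply/eqP; rewrite EI.
(* The two sides differ by a multiple of the equation defining s. *)
transitivity (N * d ^+ 2 * (s ^+ 2 - (d ^+ 2 + 4 * N * (q * (1 - q))))
              / (4 * (d ^+ 2 + N))); first by field.
by rewrite s2 subrr mulr0 mul0r.
Qed.

(** Once [u = log log n] is at least [1] and dominates the constants, the
    numerator of [hc_d] is at least [u], which gives
    [hc_d t n >= sqrt (u / 2)]. *)
Lemma hc_d_cvgy (R : realType) (t : R) : hc_d t n @[n --> \oo] --> +oo.
Proof.
have uy (C : R) : \forall n \near \oo, C <= hc_u n.
  near=> n.
  have n1 : expR (expR C) <= n%:R :> R by near: n; exact: nbhs_infty_ger.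
  have n0 : 0 < n%:R :> R by apply: lt_le_trans n1; rewrite expR_gt0.
  have l1 : expR C <= ln n%:R by rewrite -ler_expR lnK.
  have l0 : 0 < ln n%:R :> R by apply: lt_le_trans l1; rewrite expR_gt0.
  by rewrite /hc_u -ler_expR lnK.
apply/cvgryPge => C; near=> n.
have u1 : 1 <= hc_u n :> R by near: n; exact: uy.
have ut : ln pi / 2 - t <= hc_u n by near: n; exact: uy.
have uC : 2 * C ^+ 2 <= hc_u n by near: n; exact: uy.
rewrite /hc_d; move: (hc_u n) u1 ut uC => u u1 ut uC.
have lu : 0 <= ln u by exact: ln_ge0.
have u0 : 0 < u by exact: lt_le_trans u1.
have s2 : Num.sqrt (2 * u) ^+ 2 = 2 * u by rewrite sqr_sqrtr// mulr_ge0// ltW.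
have s0 : 0 < Num.sqrt (2 * u) by rewrite sqrtr_gt0 mulr_gt0.
rewrite ler_pdivlMr//; apply: (@le_trans _ _ u); last by lra.
move: (Num.sqrt _) s2 s0 => s s2 s0.
have [C0|C0] := leP C 0.
  by apply: (@le_trans _ _ 0); [rewrite mulr_le0_ge0// ltW|exact: ltW].
rewrite -ler_sqr ?nnegrE ?mulr_ge0 ?(ltW s0) ?(ltW u0) ?(ltW C0)//.
have -> : (C * s) ^+ 2 = (2 * C ^+ 2) * u by rewrite exprMn s2; ring.
by rewrite [leRHS]expr2 ler_pM2r.
Unshelve. all: by end_near.
Qed.

(** * Counting pairwise independent events *)

Lemma indic_Lfun (disp : measure_display) (T : measurableType disp)
    (R : realType) (P : probability T R) (A : set T) (r : R) :
  0 < r -> measurable A -> (\1_A : T -> R) \in Lfun P r%:E.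
Proof.
move=> r0 mA; rewrite inE; apply/andP; split; rewrite inE/=.
  exact: measurable_indic.
rewrite /finite_norm unlock poweR_lty//.
have pow1 x : (`|\1_A x : R| `^ r)%R = \1_A x.
  rewrite indicE; case: (x \in A); rewrite ?normr1 ?powR1//.
  by rewrite normr0 powR0// gt_eqF.
rewrite (eq_integral (fun x => (\1_A x)%:E)) => [|x _]; last by rewrite -pow1.
by rewrite integral_indic// setIT (le_lt_trans (probability_le1 P mA))// ltry.
Qed.

Lemma variance_sum_uncorrelated (disp : measure_display)
    (T : measurableType disp) (R : realType) (P : probability T R)
    (I : eqType) (s : seq I) (X : I -> T -> R) : uniq s ->
  (forall i, X i \in Lfun P 2%:E) ->
  (forall i j, i != j -> covariance P (X i) (X j) = 0%E) ->
  'V_P[\sum_(i <- s) X i] = (\sum_(i <- s) 'V_P[X i])%E.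
Proof.
move=> + X2 X0; elim: s => [_|a s IH /= /andP[as_ us]].
  by rewrite !big_nil; exact: variance_cst.
have S2 (u : seq I) : \sum_(i <- u) X i \in Lfun P 2%:E.
  by rewrite rpred_sum ?lee1n// => L i _; exact: X2.
rewrite !big_cons varianceD// IH//.
suff -> : covariance P (X a) (\sum_(i <- s) X i) = 0%E by rewrite mule0 adde0.
elim: s as_ {us IH} => [_|b s IH]; first by rewrite big_nil covariance_cst_r.
rewrite inE negb_or => /andP[ab as_]; rewrite big_cons covarianceDr//.
by rewrite X0// IH// adde0.
Qed.

(** Pairwise independence is all that Chebyshev's inequality needs: it makes
    the indicators uncorrelated, so that the count of the events that occur
    has the mean and variance of a binomial variable. *)
Lemma count_deviation (disp : measure_display) (T : measurableType disp)
    (R : realType) (P : probability T R) (I : finType) (A : I -> set T)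
    (p eps : R) :
  (forall j, measurable (A j)) -> (forall j, P (A j) = p%:E) ->
  (forall j k, j != k -> P (A j `&` A k) = (p * p)%:E) ->
  0 < eps ->
  (P [set w | (eps <= `|\sum_j \1_(A j) w - #|I|%:R * p|)%R]
     <= (#|I|%:R * (p * (1 - p)) / eps ^+ 2)%:E)%E.
Proof.
move=> mA PA PAA eps0.
pose X (j : I) : T -> R := \1_(A j).
have X2 j : X j \in Lfun P 2%:E by exact: indic_Lfun.
have X1 j : X j \in Lfun P 1 by exact: indic_Lfun.
have EX j : 'E_P[X j]%E = p%:E by rewrite expectation_indic.
have XI j k : X j * X k = \1_(A j `&` A k) by rewrite indicI.
have covX j k : covariance P (X j) (X k) = (P (A j `&` A k) - (p * p)%:E)%E.
  rewrite covarianceE ?EX//; last exact: Lfun2_mul_Lfun1.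
  by rewrite XI expectation_indic//; exact: measurableI.
pose S : T -> R := \sum_j X j.
have mS : measurable_fun setT S.
  have : S \in Lfun P 1 by rewrite rpred_sum// => j _; exact: X1.
  by move=> /Lfun1_integrable/measurable_int/measurable_EFinP.
pose mfS := @isMeasurableFun.Build _ _ _ _ S mS.
pose SR : {RV P >-> R} := HB.pack S mfS.
have ES : 'E_P[SR]%E = (#|I|%:R * p)%:E.
  rewrite -[SR : T -> R]/S /S -(big_map X xpredT id) expectation_sum; last first.
    by move=> Y /mapP[j _ ->].
  rewrite big_map; under eq_bigr => j _ do rewrite EX.
  by rewrite sumEFin sumr_const mulr_natl.
have VS : 'V_P[SR] = (#|I|%:R * (p * (1 - p)))%:E.
  rewrite -[SR : T -> R]/S variance_sum_uncorrelated ?index_enum_uniq//.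
    under eq_bigr => j _ do rewrite /variance covX setIid PA -EFinB.
    by rewrite sumEFin sumr_const mulrBr mulr1 mulr_natl.
  by move=> j k jk; rewrite covX PAA// subee.
under eq_set => w.
  have -> : \sum_j \1_(A j) w = SR w by rewrite /= /S fct_sumE.
  over.
by have := chebyshev SR eps0; rewrite VS ES -EFinM [eps ^- 2 * _]mulrC.
Qed.

(** * Order statistics of a uniform sample *)

Lemma order_stat_lt (R : realType) (disp : measure_display)
    (T : measurableType disp) (P : probability T R) (n i : nat)
    (U : 'I_n -> {RV P >-> R}) (x : R) (w : T) : (0 < i <= n)%N ->
  (order_stat U i w < x) = (i <= #|[pred j | (U j w < x)%R]|)%N.
Proof.
move=> /andP[i0 lein]; rewrite /order_stat.
set s := [seq U j w | j <- _].
have ss : sorted <=%R (sort <=%R s) by exact: sort_le_sorted.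
have -> : #|[pred j | (U j w < x)%R]| = count (< x) (sort <=%R s).
  by rewrite count_sort count_map enumT cardE /enum_mem size_filter.
apply/idP/idP => [|h]; last by apply: nth_count_lt; rewrite // prednK.
apply: contraLR; rewrite -ltnNge -leNgt => h.
apply: nth_count_ge; rewrite // size_sort size_map size_enum_ord prednK// lein.
by rewrite -ltnS prednK// h.
Qed.

Lemma uniform01_lt (R : realType) (disp : measure_display)
    (T : measurableType disp) (P : probability T R) (X : {RV P >-> R}) (x : R) :
  uniform01 X -> 0 < x < 1 -> P (X @^-1` [set y | y < x]) = x%:E.
Proof.
move=> /(_ [set y | y < x]) uX /andP[x0 x1].
have mx : measurable [set y | y < x] by rewrite -set_itvNyo.
have := uX mx; rewrite /distribution/= /pushforward => ->.
rewrite /uniform_prob integral_uniform_pdf.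
have -> : [set y | y < x] `&` `[0, 1] = `[0, x[%classic :> set R.
  apply/seteqP; split => y /=; rewrite !in_itv/=.
    by move=> [-> /andP[->]].
  by move=> /andP[-> yx]; split=> //; exact: ltW (lt_trans yx x1).
under eq_integral => y.
  rewrite inE/= in_itv/= => /andP[y0 yx].
  rewrite /uniform_pdf y0 (ltW (lt_trans yx x1)) subr0 invr1; over.
by rewrite integral_cst//= mul1e lebesgue_measure_itv/= lte_fin x0 sube0.
Qed.

(** Chebyshev's inequality for the number of sample points below [x], whose
    mean [n x] is exceeded by at least [i - n x] on the event. *)
Lemma uniform_order_stat_lt_le (R : realType) (disp : measure_display)
    (T : measurableType disp) (P : probability T R) (n i : nat)
    (U : 'I_n -> {RV P >-> R}) (x : R) :
  iid_uniform01 U -> (0 < i <= n)%N -> 0 < x < 1 -> 0 < i%:R - n%:R * x ->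
  (P [set w | (order_stat U i w < x)%R]
     <= (n%:R * (x * (1 - x)) / (i%:R - n%:R * x) ^+ 2)%:E)%E.
Proof.
move=> [indU unifU] ilen x01 gap.
pose A j : set T := U j @^-1` [set y | y < x].
have mlt : measurable [set y : R | y < x] by rewrite -set_itvNyo.
have mA j : measurable (A j).
  by rewrite -[A j]setTI; exact: measurable_funPT.
have PA j : P (A j) = x%:E by exact: uniform01_lt.
have PAA j k : j != k -> P (A j `&` A k) = (x * x)%:E.
  move=> jk; have := indU [set j; k]%SET (fun=> [set y | y < x]) (fun=> mlt).
  rewrite big_setU1 ?inE//= big_set1 [P (U j @^-1` _)]PA [P (U k @^-1` _)]PA.
  move=> E; rewrite EFinM -E; congr (P _); apply/seteqP; split => w /=.
    by move=> [Aj Ak] l /=; rewrite !inE => /orP[] /eqP ->.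
  by move=> H; split; apply: H; rewrite /= !inE eqxx ?orbT.
have sumA w : #|[pred j | U j w < x]|%:R = \sum_j \1_(A j) w :> R.
  rewrite -sum1_card natr_sum big_mkcond /=; apply: eq_bigr => j _.
  rewrite indicE inE; case: ifPn => hj; first by rewrite mem_set.
  by rewrite memNset//; apply/negP.
have mS : measurable_fun setT (fun w => \sum_j \1_(A j) w : R).
  by apply: measurable_sum => j; exact: measurable_indic.
set B := [set w | _].
set C := [set w | i%:R - n%:R * x <= `|\sum_j \1_(A j) w - n%:R * x|]%R.
have BE : B = (fun w => \sum_j \1_(A j) w : R) @^-1` `[i%:R, +oo[.
  apply/seteqP; split => w;
    by rewrite /B /= in_itv/= andbT -sumA ler_nat order_stat_lt.
have mB : measurable B by rewrite BE -[X in measurable X]setTI; exact: mS.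
have mC : measurable C.
  have -> : C = (fun w => `|\sum_j \1_(A j) w - n%:R * x|)
                  @^-1` `[i%:R - n%:R * x, +oo[.
    by apply/seteqP; split => w; rewrite /C /= in_itv/= andbT.
  rewrite -[X in measurable X]setTI.
  have : measurable_fun setT (fun w => `|\sum_j \1_(A j) w - n%:R * x|).
    by apply: measurableT_comp => //; exact: measurable_funB.
  exact.
have BC : B `<=` C.
  move=> w; rewrite BE /C /= in_itv/= andbT => iS.
  by rewrite (le_trans _ (ler_norm _))// lerB.
apply: (le_trans (le_measure P (mem_set mB) (mem_set mC) BC)).
by have := count_deviation mA PA PAA gap; rewrite card_ord.
Qed.

(** * The local levels *)

(** By [hc_h_boundary], the ratio of the variance to the squared gap in
    Chebyshev's bound is exactly [1 / d ^ 2], whatever [i] is. *)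
Lemma hc_local_level_le (R : realType) (t : R) (disp : measure_display)
    (T : measurableType disp) (P : probability T R) (n i : nat)
    (U : 'I_n -> {RV P >-> R}) :
  iid_uniform01 U -> (0 < i <= n)%N -> 0 < hc_d t n ->
  hc_local_level t U i <= (hc_d t n) ^- 2.
Proof.
move=> iidU ilen d0; rewrite /hc_local_level.
have [] := hc_h_boundary ilen d0.
move: (hc_d t n) d0 => d d0; move: (hc_h n i d) => h gap gap2.
have V0 : 0 < n%:R * (h * (1 - h)).
  by rewrite -(pmulr_rgt0 _ (exprn_gt0 2 d0)) -gap2 exprn_gt0.
have N0 : (0 : R) < n%:R.
  by case/andP: ilen => i0 lein; rewrite ltr0n (leq_trans i0).
have h01 : 0 < h < 1.
  by move: V0; rewrite pmulr_rgt0// => hh; apply/andP; split; nra.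
have := uniform_order_stat_lt_le iidU ilen h01 gap.
rewrite gap2 invfM mulrCA divff ?gt_eqF// mulr1 => PB.
rewrite -lee_fin fineK// ge0_fin_numE ?measure_ge0//.
exact: le_lt_trans PB (ltry _).
Qed.

Theorem theorem5p2 (R : realType) (t : R)
    (d : nat -> measure_display)
    (T : forall n : nat, measurableType (d n))
    (P : forall n : nat, probability (T n) R)
    (U : forall n : nat, 'I_n -> {RV (P n) >-> R})
    (hU : forall n : nat, iid_uniform01 (U n)) :
  hc_max_local_level t (U n) @[n --> \oo] --> (0 : R).
Proof.
have lim0 : (hc_d t n) ^- 2 @[n --> \oo] --> (0 : R).
  have V0 : (hc_d t n)^-1 @[n --> \oo] --> (0 : R).
    apply/gtr0_cvgV0; last exact: hc_d_cvgy.
    by apply: (cvgryPgt _).1; exact: hc_d_cvgy.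
  rewrite -[0 in X in _ --> X](mulr0 (0 : R)).
  under eq_fun => n do rewrite -exprVn expr2.
  exact: cvgM.
apply: (squeeze_cvgr _ (cvg_cst 0) lim0); near=> n.
have d0 : 0 < hc_d t n.
  by near: n; apply: (cvgryPgt _).1; exact: hc_d_cvgy.
have i0 : 0 <= hc_d t n ^- 2 by rewrite invr_ge0 exprn_ge0// ltW.
rewrite /hc_max_local_level bigmax_ge_id/=.
rewrite big_seq; apply: bigmax_le => // i.
by rewrite mem_index_iota ltnS => ilen; exact: hc_local_level_le.
Unshelve. all: by end_near.
Qed.
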